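(* Let $s\in(0,1]$, let $I\subset(0,\infty)$ be an interval, let $f:I\to\mathbb{R}$ be differentiable on $I^\circ$, let $a,b\in I$ with $a<b$, and suppose $f'\in L[a,b]$. Let $q\ge 1$. If $|f'|^q$ is harmonically $s$-convex on $[a,b]$, then for all $x\in[a,b]$, $$\left|f(x)-\frac{ab}{b-a}\int_a^b\frac{f(u)}{u^2}\,du\right|\le\frac{ab}{b-a}\Big\{\lambda_5(a,x)^{1-\frac1q}(x-a)^2\big(\lambda_1(a,x,s,1,1)|f'(x)|^q+\lambda_2(a,x,s,1,1)|f'(a)|^q\big)^{1/q}+\lambda_5(b,x)^{1-\frac1q}(b-x)^2\big(\lambda_3(b,x,s,1,1)|f'(x)|^q+\lambda_4(b,x,s,1,1)|f'(b)|^q\big)^{1/q}\Big\},$$ where $$\lambda_5(\theta,x)=\frac{1}{x-\theta}\left\{\frac1\theta-\frac{\ln x-\ln\theta}{x-\theta}\right\}.$$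
   Context: For fixed $s\in(0,1]$ and a real interval $J\subset(0,\infty)$, a function $g:J\to\mathbb{R}$ is harmonically $s$-convex if $g\left(\frac{xy}{tx+(1-t)y}\right)\le t^s g(y)+(1-t)^s g(x)$ for all $x,y\in J$ and $t\in[0,1]$. $I^\circ$ is the interior of $I$; $L[a,b]$ denotes the Lebesgue integrable functions on $[a,b]$. Since $f'$ is used on all of $[a,b]$, $f$ is understood to be differentiable at every point of $[a,b]$ (one-sided at a point of $[a,b]$ that is an endpoint of $I$). The functions $\lambda_1,\dots,\lambda_4$ are defined for $0<a\le x$ (for $\lambda_1,\lambda_2$) and $0<x\le b$ (for $\lambda_3,\lambda_4$) by $$\lambda_1(a,x,s,\vartheta,\rho)=\frac{\beta(\rho+s+1,1)}{x^{2\vartheta}}\,{}_2F_1\left(2\vartheta,\rho+s+1;\rho+s+2;1-\frac ax\right),$$ $$\lambda_2(a,x,s,\vartheta,\rho)=\frac{\beta(\rho+1,s+1)}{x^{2\vartheta}}\,{}_2F_1\left(2\vartheta,\rho+1;\rho+s+2;1-\frac ax\right),$$ $$\lambda_3(b,x,s,\vartheta,\rho)=\frac{\beta(1,\rho+s+1)}{b^{2\vartheta}}\,{}_2F_1\left(2\vartheta,1;\rho+s+2;1-\frac xb\right),$$ $$\lambda_4(b,x,s,\vartheta,\rho)=\frac{\beta(s+1,\rho+1)}{b^{2\vartheta}}\,{}_2F_1\left(2\vartheta,s+1;\rho+s+2;1-\frac xb\right).$$ Here $\beta(u,v)=\int_0^1t^{u-1}(1-t)^{v-1}\,dt$ for $u,v>0$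 is the Euler Beta function, and ${}_2F_1(\alpha,\gamma;c;z)=\frac{1}{\beta(\gamma,c-\gamma)}\int_0^1t^{\gamma-1}(1-t)^{c-\gamma-1}(1-zt)^{-\alpha}\,dt$ for $c>\gamma>0$, $|z|<1$, is the hypergeometric function. When $x=\theta$, $\lambda_5(\theta,x)$ is given its limiting value $\frac{1}{2\theta^2}$; it then appears multiplied by $0$, so the corresponding summand is $0$. *)

(* Defs.v *)
From HB Require Import structures.
From mathcomp Require Import all_boot all_order all_algebra.
From mathcomp Require Import all_classical all_reals all_analysis.
Set Implicit Arguments.
Unset Strict Implicit.
Unset Printing Implicit Defensive.
Import Order.TTheory GRing.Theory Num.Theory.
Import numFieldNormedType.Exports.
Local Open Scope classical_set_scope.
Local Open Scope ring_scope.

(* A real function on a set A is encoded as a total function R -> R of which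
   only the values on A are used. *)

(* Derivative at x relative to the domain A: [derive1] with the increments h
   restricted to those for which h + x stays in A.  It is the usual derivative
   at interior points of A (lemmas below), and the one-sided derivative at an
   endpoint when A is an interval. *)
Definition derivable_in (R : realType) (A : set R) (f : R -> R) (x : R) : Prop :=
  cvg ((fun h : R => h^-1 * (f (h + x) - f x))
         @ within [set h | A (h + x)] 0^').

Definition derive1_in (R : realType) (A : set R) (f : R -> R) (x : R) : R :=
  lim ((fun h : R => h^-1 * (f (h + x) - f x))
         @ within [set h | A (h + x)] 0^').

Lemma within_dnbhs_interior (R : realType) (A : set R) (x : R) :
  A° x -> within [set h | A (h + x)] 0^' = 0^'.
Proof.
move=> Ax; have nA : \forall h \near (0 : R)^', A (h + x).
  apply: cvg_within.
  have : (fun h : R => h + x) @ (0 : R) --> x.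
    rewrite -[X in _ --> X]add0r; apply: cvgD; [exact: cvg_id|exact: cvg_cst].
  by apply.
apply/seteqP; split => [P wP|P]; last exact: cvg_within.
have {}wP : \forall h \near (0 : R)^', A (h + x) -> P h := wP.
by near=> h; apply: (near wP h) => //; near: h.
Unshelve. all: by end_near. Qed.

Lemma derivable_in_interior (R : realType) (A : set R) (f : R -> R) (x : R) :
  A° x -> derivable_in A f x <-> derivable f x 1.
Proof.
move=> Ax; rewrite /derivable_in within_dnbhs_interior// /derivable.
by under [X in _ <-> cvg (X @ _)]eq_fun do rewrite [_%:A]mulr1.
Qed.

Lemma derive1_in_interior (R : realType) (A : set R) (f : R -> R) (x : R) :
  A° x -> derive1_in A f x = derive1 f x.
Proof. by move=> Ax; rewrite /derive1_in within_dnbhs_interior. Qed.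

Definition harmonically_s_convex (R : realType) (s : R) (J : set R)
    (g : R -> R) : Prop :=
  forall x y t : R, J x -> J y -> 0 <= t <= 1 ->
    g (x * y / (t * x + (1 - t) * y)) <= t `^ s * g y + (1 - t) `^ s * g x.

(* The library's [beta_fun] only takes natural number arguments. *)
Definition Beta (R : realType) (u v : R) : R :=
  \int[@lebesgue_measure R]_(t in `[0, 1]) (t `^ (u - 1) * (1 - t) `^ (v - 1)).

(* Euler's integral; meaningful for 0 < gamma < c and |z| < 1. *)
Definition hyp2F1 (R : realType) (alpha gamma c z : R) : R :=
  (Beta gamma (c - gamma))^-1 *
  \int[@lebesgue_measure R]_(t in `[0, 1])
     (t `^ (gamma - 1) * (1 - t) `^ (c - gamma - 1) * (1 - z * t) `^ (- alpha)).

Definition lambda1 (R : realType) (a x s vt rho : R) : R :=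
  Beta (rho + s + 1) 1 / x `^ (2 * vt) *
  hyp2F1 (2 * vt) (rho + s + 1) (rho + s + 2) (1 - a / x).

Definition lambda2 (R : realType) (a x s vt rho : R) : R :=
  Beta (rho + 1) (s + 1) / x `^ (2 * vt) *
  hyp2F1 (2 * vt) (rho + 1) (rho + s + 2) (1 - a / x).

Definition lambda3 (R : realType) (b x s vt rho : R) : R :=
  Beta 1 (rho + s + 1) / b `^ (2 * vt) *
  hyp2F1 (2 * vt) 1 (rho + s + 2) (1 - x / b).

Definition lambda4 (R : realType) (b x s vt rho : R) : R :=
  Beta (s + 1) (rho + 1) / b `^ (2 * vt) *
  hyp2F1 (2 * vt) (s + 1) (rho + s + 2) (1 - x / b).

(* The value at x = theta is the limit of the formula as x tends to theta. *)
Definition lambda5 (R : realType) (theta x : R) : R :=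
  if x == theta then (2 * theta ^+ 2)^-1
  else (x - theta)^-1 * (theta^-1 - (ln x - ln theta) / (x - theta)).

(* Main.v *)
Require Import Defs.
From HB Require Import structures.
From mathcomp Require Import all_boot all_order all_algebra.
From mathcomp Require Import all_classical all_reals all_analysis.
From mathcomp Require Import ring lra.
Set Implicit Arguments.
Unset Strict Implicit.
Unset Printing Implicit Defensive.
Import Order.TTheory GRing.Theory Num.Theory.
Import numFieldNormedType.Exports.
Local Open Scope classical_set_scope.
Local Open Scope ring_scope.

(** Let F be a primitive of f(u)/u^2 on [a, b].  For w in {a, b} and x <> w, put
    D(t) = t w + (1 - t) x and u(t) = w x / D(t), so that 1/w - 1/u(t) is linear
    in t.  The function P(t) = (1/w - 1/u(t)) f(u(t)) - F(u(t)) has derivative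
    (x - w)^2 (t / D(t)^2) f'(u(t)).  Harmonic s-convexity bounds |f'(u(t))|^q by
    t^s |f'(x)|^q + (1 - t)^s |f'(w)|^q, and Young's inequality turns this into a
    bound of |f'(u(t))| itself, with a free scale c > 0.  Thus |P'| lies below an
    explicit continuous function and the mean value theorem bounds |P(1) - P(0)|
    by its integral; no integral of f' is ever taken.  Optimizing over c yields
    the power mean shape of the estimate, and the integrals of the kernels are
    the lambda_i.  The cases w = a and w = b are subtracted. *)

(** * Continuity on intervals and bounds for increments *)

Lemma within_continuous_comp_within (R : realType) (A B : set R) (f g : R -> R) :
  (forall t, A t -> B (g t)) ->
  {within A, continuous g} -> {within B, continuous f} ->
  {within A, continuous (f \o g)}.
Proof.
move=> AB /subspace_continuousP cg /subspace_continuousP cf.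
apply/subspace_continuousP => t At; apply: cvg_trans (cf _ (AB _ At)).
move=> P /= [e e0 eP]; have [d d0 dP] := cg _ At _ (nbhsx_ballx (g t) e e0).
by exists d => // z zd Az; apply: eP; [exact: dP|exact: AB].
Qed.

Lemma integrable_within_continuous (R : realType) (a b : R) (f : R -> R) :
  {within `[a, b], continuous f} ->
  (@lebesgue_measure R).-integrable `[a, b] (EFin \o f).
Proof.
by move=> cf; apply: continuous_compact_integrable => //; exact: segment_compact.
Qed.

Lemma is_derive_parameterized_integral (R : realType) (a b x : R)
    (f : R -> R) : {within `[a, b], continuous f} -> x \in `]a, b[ ->
  is_derive x 1
    (fun y => \int[@lebesgue_measure R]_(t in `[a, y]) f t) (f x).
Proof.
move=> cf xab.
have [ax xb] : a < x /\ x < b by rewrite !(itvP xab).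
have [dF Ff] := continuous_FTC1_closed xb (integrable_within_continuous cf) ax
  (within_continuous_continuous (lt_trans ax xb) cf xab).
by split; [exact: dF|rewrite -derive1E; exact: Ff].
Qed.

(** The mean value theorem applies to [H - F], where [H] is the primitive of [h] vanishing at [a]:
    its slope [h - f] is nonnegative at the intermediate point. Only the continuous majorant [h]
    gets integrated. *)
Lemma le_increment_Rintegral (R : realType) (a b : R) (F f h : R -> R) :
  a < b -> {within `[a, b], continuous F} -> {within `[a, b], continuous h} ->
  (forall x, x \in `]a, b[ -> is_derive x 1 F (f x)) ->
  (forall x, x \in `]a, b[ -> f x <= h x) ->
  F b - F a <= \int[@lebesgue_measure R]_(t in `[a, b]) h t.
Proof.
move=> ab cF ch dF fh.
pose H y := \int[@lebesgue_measure R]_(t in `[a, y]) h t.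
have dHF x : x \in `]a, b[ -> is_derive x 1 (H - F) (h x - f x).
  move=> xab; apply: is_deriveB; last exact: dF.
  exact: is_derive_parameterized_integral.
have cHF : {within `[a, b], continuous (H - F)}.
  move=> x; apply: continuousB; last exact: cF.
  apply: parameterized_integral_continuous; first exact: ltW.
  exact: integrable_within_continuous.
have [c cab] := MVT ab dHF cHF.
rewrite !fctE /H set_itv1 Rintegral_set1 sub0r opprK => E.
have : 0 <= (h c - f c) * (b - a).
  by rewrite mulr_ge0// subr_ge0; [exact: fh|exact: ltW].
by rewrite -E; lra.
Qed.

(** The one-sided bound is applied to [F] and to [- F]. *)
Lemma le_norm_increment_Rintegral (R : realType) (a b : R) (F f h : R -> R) :
  a < b -> {within `[a, b], continuous F} -> {within `[a, b], continuous h} ->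
  (forall x, x \in `]a, b[ -> is_derive x 1 F (f x)) ->
  (forall x, x \in `]a, b[ -> `|f x| <= h x) ->
  `|F b - F a| <= \int[@lebesgue_measure R]_(t in `[a, b]) h t.
Proof.
move=> ab cF ch dF fh; rewrite ler_norml; apply/andP; split; last first.
  apply: le_increment_Rintegral dF _ => // x /fh; exact/le_trans/ler_norm.
rewrite lerNl opprB; have := @le_increment_Rintegral R a b (- F) (- f) h ab.
rewrite !fctE opprK [- F b + _]addrC; apply => //.
- by move=> x; apply: continuousN; exact: cF.
- by move=> x xab; apply: is_deriveN; exact: dF.
- by move=> x /fh; apply: le_trans; rewrite -normrN ler_norm.
Qed.

(** * Powers and the Beta integrand *)

(** [powR] takes a default value at negative bases, which spoils continuity at 0. The absolute value
    removes this, so that continuity on [[0, 1]] can be deduced from continuity on the whole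
    line. *)
Lemma continuous_norm_powR (R : realType) (p t : R) : 0 <= p ->
  {for t, continuous (fun z : R => `|z| `^ p)}.
Proof.
rewrite le_eqVlt => /predU1P[<-|p0].
  (* For [p = 0] the power is constantly 1, even at 0. *)
  rewrite /prop_for /continuous_at powRr0.
  by under eq_fun do rewrite powRr0; exact: cvg_cst.
have [->|t0] := eqVneq t 0.
  apply/cvgrPdist_lt => e e0; near=> z.
  rewrite normr0 powR0 ?gt_eqF// sub0r normrN ger0_norm ?powR_ge0//.
  (* Writing [e] as the [p]-th power of its [p]-th root makes that root the radius of the
     neighbourhood. *)
  have -> : e = (e `^ p^-1) `^ p.
    by rewrite -powRrM mulVf ?gt_eqF// powRr1// ltW.
  apply: gt0_ltr_powR => //; rewrite ?nnegrE ?powR_ge0//.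
  near: z; exists (e `^ p^-1); first by rewrite /= powR_gt0.
  by move=> z /=; rewrite sub0r normrN.
have cp : {for `|t|, continuous (fun z : R => z `^ p)}.
  apply/differentiable_continuous/derivable1_diffP.
  by apply: derivable_powR; rewrite in_itv/= andbT normr_gt0.
exact: (continuous_comp (@norm_continuous _ R t) cp).
Unshelve. all: by end_near. Qed.

Lemma within01_continuous_powRM (R : realType) (p r : R) :
  0 <= p -> 0 <= r ->
  {within `[0, 1], continuous (fun t : R => t `^ p * (1 - t) `^ r)}.
Proof.
move=> p0 r0; pose g (t : R) := `|t| `^ p * `|1 - t| `^ r.
apply: (@subspace_eq_continuous _ _ _ g).
  move=> t /set_mem /=; rewrite in_itv/= => /andP[t0 t1].
  by rewrite /g !ger0_norm// subr_ge0.
apply: continuous_subspaceT => t.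
have c1 : {for t, continuous (fun z : R => 1 - z)}.
  by apply: continuousB; [exact: cvg_cst|exact: cvg_id].
have c2 : {for t, continuous (fun z : R => `|1 - z| `^ r)}.
  apply: (@cvg_comp _ _ _ (fun z : R => 1 - z) (fun z => `|z| `^ r) _ _ _ c1).
  exact: continuous_norm_powR.
exact: continuousM (continuous_norm_powR p0) c2.
Qed.

(** By the mean value theorem for the primitive, the integral equals [f c * (b - a)] at an interior
    point [c]. The integrand may thus vanish at the ends, as Beta integrands do. *)
Lemma Rintegral_within_continuous_gt0 (R : realType) (a b : R) (f : R -> R) :
  a < b -> {within `[a, b], continuous f} ->
  (forall x, x \in `]a, b[ -> 0 < f x) ->
  0 < \int[@lebesgue_measure R]_(t in `[a, b]) f t.
Proof.
move=> ab cf f0.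
pose H y := \int[@lebesgue_measure R]_(t in `[a, y]) f t.
have dH x : x \in `]a, b[ -> is_derive x 1 H (f x).
  exact: is_derive_parameterized_integral.
have cH : {within `[a, b], continuous H}.
  apply: parameterized_integral_continuous; first exact: ltW.
  exact: integrable_within_continuous.
have [c cab] := MVT ab dH cH.
rewrite {2}/H set_itv1 Rintegral_set1 subr0 => HE.
by rewrite -/(H b) HE mulr_gt0 ?subr_gt0// f0.
Qed.

(** Arguments at least 1 keep the integrand continuous up to 0 and 1; the arguments arising from the
    [lambda] functions are of this kind. Positivity lets [Beta] cancel against its inverse in
    [hyp2F1]. *)
Lemma Beta_gt0 (R : realType) (u v : R) : 1 <= u -> 1 <= v -> 0 < Beta u v.
Proof.
move=> u1 v1; apply: Rintegral_within_continuous_gt0 => //.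
  by apply: within01_continuous_powRM; rewrite subr_ge0.
by move=> x x01; rewrite mulr_gt0// powR_gt0// ?subr_gt0 (itvP x01).
Qed.

(** * Young's inequality and optimization over the scale *)

(** This is Young's inequality for [h / c] and 1 with exponents [q] and [q / (q - 1)], multiplied by
    [c]. As a function of the [q]-th power of [h], the right side is the tangent line of the [q]-th
    root, with contact at [h = c]. *)
Lemma le_scaled_powR (R : realType) (q h c : R) : 1 <= q -> 0 <= h -> 0 < c ->
  h <= c / c `^ q * h `^ q / q + (1 - q^-1) * c.
Proof.
move=> q1 h0 c0; have q0 : 0 < q by lra.
have cq : 0 < c `^ q by rewrite powR_gt0.
(* The conjugate exponent is infinite for [q = 1], where the bound is an equality. *)
have [<-|q1'] := eqVneq 1 q.
  by rewrite !powRr1 ?(ltW c0)// invr1 subrr mul0r addr0 mulr1 divff ?gt_eqF// mul1r.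
have {}q1 : 1 < q by rewrite lt_neqAle q1' q1.
have hE : h `^ q = (h / c) `^ q * c `^ q.
  by rewrite -powRM ?divr_ge0 ?(ltW c0)// divfK ?gt_eqF.
have pE : q^-1 + (q / (q - 1))^-1 = 1 by field; lra.
have p0 : 0 < q / (q - 1) by rewrite divr_gt0// subr_gt0.
have := conjugate_powR (divr_ge0 h0 (ltW c0)) (@ler01 R) q0 p0 pE.
rewrite mulr1 powR1 mul1r => H.
have -> : c / c `^ q * h `^ q / q + (1 - q^-1) * c =
    c * ((h / c) `^ q / q + (q / (q - 1))^-1).
  by rewrite hE; field; rewrite !gt_eqF ?subr_gt0.
by rewrite -ler_pdivrMl// mulrC.
Qed.

(* For [A > 0] the bound is optimal at [c = (A / W) `^ q^-1]. *)
Lemma le_powR_mean (R : realType) (q W A X : R) : 1 <= q -> 0 < W -> 0 <= A ->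
  (forall c, 0 < c -> X <= c / c `^ q * A / q + (1 - q^-1) * c * W) ->
  X <= W `^ (1 - q^-1) * A `^ q^-1.
Proof.
move=> q1 W0; have q0 : 0 < q by lra.
rewrite le_eqVlt => /predU1P[<-|A0] H.
  rewrite powR0 ?invr_eq0 ?gt_eqF// mulr0.
  (* The optimal scale degenerates to 0 when [A = 0]. The choice [c = e / W] leaves
     [(1 - q^-1) * e], which is at most the arbitrary [e]. *)
  apply/ler_addgt0Pl => e e0; rewrite addr0.
  have := H (e / W) (divr_gt0 e0 W0).
  rewrite mulr0 mul0r add0r -mulrA divfK ?gt_eqF// => /le_trans; apply.
  by rewrite ger_pMl// gerBl invr_ge0 ltW.
pose c := (A / W) `^ q^-1.
have c0 : 0 < c by rewrite powR_gt0 ?divr_gt0.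
apply: (le_trans (H _ c0)).
have cq : c `^ q = A / W.
  by rewrite -powRrM mulVf ?gt_eqF// powRr1// divr_ge0 ?ltW.
(* At the optimal scale both the bound and the target equal [c * W]. *)
have -> : W `^ (1 - q^-1) * A `^ q^-1 = c * W.
  rewrite powRB; last by rewrite (gt_eqF W0) implybT.
  have WV : W^-1 `^ q^-1 = (W `^ q^-1)^-1.
    by rewrite -(powR_inv1 (ltW W0)) -powRrM mulN1r powRN.
  rewrite powRr1 ?(ltW W0)// /c powRM ?invr_ge0 ?(ltW W0) ?(ltW A0)// WV.
  by ring.
by rewrite cq [leLHS](_ : _ = c * W)//; field; rewrite !gt_eqF.
Qed.

(** * Kernel integrals and the [lambda] functions *)

Lemma convex_comb_gt0 (R : realType) (w y t : R) : 0 < w -> 0 < y ->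
  t \in `[0, 1] -> 0 < t * w + (1 - t) * y.
Proof. by move=> w0 y0; rewrite in_itv/= => /andP[t0 t1]; nra. Qed.

Lemma is_derive_convex_comb (R : realType) (w y t : R) :
  is_derive t 1 (fun t : R => t * w + (1 - t) * y) (w - y).
Proof. by apply: is_derive_eq; rewrite /GRing.scale/=; ring. Qed.

Lemma within_continuousM (R : realType) (A : set R) (f g : R -> R) :
  {within A, continuous f} -> {within A, continuous g} ->
  {within A, continuous (fun t => f t * g t)}.
Proof. by move=> cf cg t; exact: continuousM (cf t) (cg t). Qed.

Lemma within01_continuous_kernel (R : realType) (w y : R) : 0 < w -> 0 < y ->
  {within `[0, 1], continuous (fun t : R => (t * w + (1 - t) * y) ^- 2)}.
Proof.
move=> w0 y0; apply: derivable_within_continuous => t t01.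
have Dt := convex_comb_gt0 w0 y0 t01.
apply: derivableV; first by rewrite expf_eq0/= gt_eqF.
have [dD _] := is_derive_convex_comb w y t.
exact: (derivableX (n := 2) dD).
Qed.

(** With [D = t * w + (1 - t) * y] one has [t = (D - y) / (w - y)], so the integrand is
    [(1 / D - y / D ^ 2) / (w - y)]. Its primitive is the function [G] of the proof. *)
Lemma kernel_Rintegral (R : realType) (w y : R) : 0 < w -> 0 < y -> y != w ->
  \int[@lebesgue_measure R]_(t in `[0, 1]) (t / (t * w + (1 - t) * y) ^+ 2) =
  lambda5 w y.
Proof.
move=> w0 y0 yw.
pose G t := (w - y) ^- 2 * (ln (t * w + (1 - t) * y) + y / (t * w + (1 - t) * y)).
have dG (t : R) : t \in `[0, 1] -> is_derive t 1 G (t / (t * w + (1 - t) * y) ^+ 2).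
  move=> t01; have Dt := convex_comb_gt0 w0 y0 t01.
  have dD := is_derive_convex_comb w y t.
  have dln : is_derive t 1 (fun t : R => ln (t * w + (1 - t) * y))
     ((t * w + (1 - t) * y)^-1 * (w - y)).
    apply: (@is_derive1_comp _ (@ln R)); exact: is_derive1_ln.
  have dV := @is_deriveV _ _ t _ 1 (lt0r_neq0 Dt) dD.
  rewrite /G; apply: is_derive_eq; rewrite /GRing.scale/=.
  by field; rewrite (gt_eqF Dt)/= subr_eq0 eq_sym yw.
have cG t : t \in `[0, 1] -> {for t, continuous G}.
  by move=> /dG[/derivable1_diffP/differentiable_continuous].
rewrite /Rintegral (@continuous_FTC2 _ _ G)//=.
- have wy : w - y != 0 by rewrite subr_eq0 eq_sym.
  rewrite /G /lambda5 (negbTE yw) subrr subr0 !mul0r !mul1r add0r addr0.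
  by field; rewrite wy -opprB oppr_eq0 wy !gt_eqF.
- apply: within_continuousM; last exact: within01_continuous_kernel.
  by apply: continuous_subspaceT => ?; exact: cvg_id.
- split.
  + by move=> t /subset_itv_oo_cc/dG[].
  + by apply: cvg_at_right_filter; apply: cG; rewrite in_itv/= lexx ler01.
  + by apply: cvg_at_left_filter; apply: cG; rewrite in_itv/= lexx ler01.
- by move=> t /subset_itv_oo_cc/dG[_ <-]; rewrite derive1E.
Qed.

(** For [z = 1 - w / y] the factor [1 - z * t] of Euler's integral is [(t * w + (1 - t) * y) / y].
    Its power [- 2] absorbs the prefactor [y ^- 2], and the two Beta factors cancel. *)
Lemma Beta_hyp2F1 (R : realType) (u v c w y : R) : 1 <= u -> 1 <= v ->
  c - u = v -> 0 < w -> 0 < y ->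
  Beta u v / y `^ (2 * 1) * hyp2F1 (2 * 1) u c (1 - w / y) =
  \int[@lebesgue_measure R]_(t in `[0, 1])
    (t `^ (u - 1) * (1 - t) `^ (v - 1) / (t * w + (1 - t) * y) ^+ 2).
Proof.
move=> u1 v1 cuv w0 y0; rewrite /hyp2F1 cuv.
have B0 : Beta u v != 0 by rewrite gt_eqF// Beta_gt0.
rewrite mulrA [X in X * _](_ : _ = y ^- 2); last first.
  rewrite mulr1 powR_mulrn ?(ltW y0)//; field.
  by rewrite B0 gt_eqF.
rewrite -RintegralZl//; last first.
  apply: integrable_within_continuous.
  (* The factor [1 - z * t] is also the convex combination of [w / y] and 1, so the continuity of
     the kernel applies to it. *)
  have cp : {within `[0, 1], continuous (fun t : R =>
      t `^ (u - 1) * (1 - t) `^ (v - 1) * (t * (w / y) + (1 - t) * 1) ^- 2)}.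
    apply: within_continuousM.
      by apply: within01_continuous_powRM; rewrite subr_ge0.
    by apply: within01_continuous_kernel; rewrite ?divr_gt0.
  apply: subspace_eq_continuous cp => t /set_mem t01.
  have Dt := convex_comb_gt0 (divr_gt0 w0 y0) ltr01 t01.
  have E : 1 - (1 - w / y) * t = t * (w / y) + (1 - t) * 1 by ring.
  by rewrite /from_subspace E [2 * 1]mulr1 powRN powR_mulrn// ltW.
apply: eq_Rintegral => t /set_mem t01.
have Dt := convex_comb_gt0 w0 y0 t01.
have -> : 1 - (1 - w / y) * t = (t * w + (1 - t) * y) / y.
  by field; rewrite gt_eqF.
rewrite mulr1 powRN powR_mulrn; last by rewrite divr_ge0// ltW.
by field; rewrite !gt_eqF.
Qed.

(** The substitution of [1 - t] for [t] reverses the kernel. It is needed for [lambda3] and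
    [lambda4], whose Euler integrals have the endpoint [b] where those of [lambda1] and [lambda2]
    have [x]. *)
Lemma kernel_weight_Rintegral_onem (R : realType) (p r w y : R) :
  0 <= p -> 0 <= r -> 0 < w -> 0 < y ->
  \int[@lebesgue_measure R]_(t in `[0, 1])
    (t `^ p * (1 - t) `^ r / (t * w + (1 - t) * y) ^+ 2) =
  \int[@lebesgue_measure R]_(t in `[0, 1])
    (t `^ r * (1 - t) `^ p / (t * y + (1 - t) * w) ^+ 2).
Proof.
move=> p0 r0 w0 y0; rewrite Rintegration_by_substitution_onem; last 2 first.
- by rewrite ler01 lexx.
- apply: within_continuousM; first exact: within01_continuous_powRM.
  exact: within01_continuous_kernel.
rewrite unstable.onem1; apply: eq_Rintegral => t _.
by rewrite /unstable.onem subKr [t * y + _]addrC [t `^ r * _]mulrC.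
Qed.

(** This and the next three evaluations bring all four functions to the kernel
    [(t * w + (1 - t) * x) ^- 2] with [w = a] or [w = b], so that a single estimate serves both
    endpoints. *)
Lemma lambda1E (R : realType) (a x s : R) : 0 < a -> 0 < x -> 0 <= s ->
  lambda1 a x s 1 1 = \int[@lebesgue_measure R]_(t in `[0, 1])
    (t `^ (s + 1) / (t * a + (1 - t) * x) ^+ 2).
Proof.
move=> a0 x0 s0; rewrite /lambda1 Beta_hyp2F1//; [|lra|ring].
apply: eq_Rintegral => t _; rewrite subrr powRr0 mulr1.
by congr (_ `^ _ / _); ring.
Qed.

Lemma lambda2E (R : realType) (a x s : R) : 0 < a -> 0 < x -> 0 <= s ->
  lambda2 a x s 1 1 = \int[@lebesgue_measure R]_(t in `[0, 1])
    (t * (1 - t) `^ s / (t * a + (1 - t) * x) ^+ 2).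
Proof.
move=> a0 x0 s0; rewrite /lambda2 Beta_hyp2F1//; [|lra|lra|ring].
apply: eq_Rintegral => t /set_mem; rewrite /= in_itv/= => /andP[t0 _].
by rewrite !addrK powRr1.
Qed.

Lemma lambda3E (R : realType) (b x s : R) : 0 < b -> 0 < x -> 0 <= s ->
  lambda3 b x s 1 1 = \int[@lebesgue_measure R]_(t in `[0, 1])
    (t `^ (s + 1) / (t * b + (1 - t) * x) ^+ 2).
Proof.
move=> b0 x0 s0; rewrite /lambda3 Beta_hyp2F1//; [|lra|ring].
rewrite kernel_weight_Rintegral_onem//; [|lra].
apply: eq_Rintegral => t _; rewrite subrr powRr0 mulr1.
by congr (_ `^ _ / _); ring.
Qed.

Lemma lambda4E (R : realType) (b x s : R) : 0 < b -> 0 < x -> 0 <= s ->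
  lambda4 b x s 1 1 = \int[@lebesgue_measure R]_(t in `[0, 1])
    (t * (1 - t) `^ s / (t * b + (1 - t) * x) ^+ 2).
Proof.
move=> b0 x0 s0; rewrite /lambda4 Beta_hyp2F1//; [|lra|lra|ring].
rewrite !addrK kernel_weight_Rintegral_onem//.
apply: eq_Rintegral => t /set_mem; rewrite /= in_itv/= => /andP[t0 _].
by rewrite powRr1.
Qed.

(** * The estimate between an endpoint and [x] *)

Lemma harmonic_comb_itvcc (R : realType) (a b w x t : R) : 0 < a ->
  w \in `[a, b] -> x \in `[a, b] -> t \in `[0, 1] ->
  w * x / (t * w + (1 - t) * x) \in `[a, b].
Proof.
move=> a0 + + t01; rewrite !in_itv/= => /andP[aw wb] /andP[ax xb].
have w0 := lt_le_trans a0 aw; have x0 := lt_le_trans a0 ax.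
have Dt := convex_comb_gt0 w0 x0 t01; move: t01; rewrite in_itv/= => /andP[t0 t1].
rewrite ler_pdivlMr// ler_pdivrMr//.
have tw : 0 <= t * w by rewrite mulr_ge0// ltW.
have tx : 0 <= (1 - t) * x by rewrite mulr_ge0 ?subr_ge0// ltW.
by apply/andP; split; clear Dt; nra.
Qed.

(** The denominator lies strictly between [w] and [x], hence so does the quotient. Strictness
    matters because [f] and [F] are differentiated only in the open interval. *)
Lemma harmonic_comb_itvoo (R : realType) (a b w x t : R) : 0 < a ->
  w \in `[a, b] -> x \in `[a, b] -> x != w -> t \in `]0, 1[ ->
  w * x / (t * w + (1 - t) * x) \in `]a, b[.
Proof.
move=> a0; rewrite !in_itv/= => /andP[aw wb] /andP[ax xb] xw /andP[t0 t1].
have w0 := lt_le_trans a0 aw; have x0 := lt_le_trans a0 ax.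
have Dt : 0 < t * w + (1 - t) * x.
  by rewrite addr_gt0// mulr_gt0// subr_gt0.
have t1' : 0 < 1 - t by rewrite subr_gt0.
rewrite ltr_pdivlMr// ltr_pdivrMr//.
set D := t * w + (1 - t) * x in Dt *.
have Dw : D - w = (1 - t) * (x - w) by rewrite /D; ring.
have Dx : D - x = t * (w - x) by rewrite /D; ring.
have [wx|wx] := ltP w x.
  have wD : 0 < D - w by rewrite Dw mulr_gt0 ?subr_gt0.
  have xD : D - x < 0 by rewrite Dx pmulr_rlt0// subr_lt0.
  by apply/andP; split; clear Dw Dx; nra.
have {}wx : x < w by rewrite lt_neqAle xw.
have wD : D - w < 0 by rewrite Dw pmulr_rlt0// subr_lt0.
have xD : 0 < D - x by rewrite Dx mulr_gt0 ?subr_gt0.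
by apply/andP; split; clear Dw Dx; nra.
Qed.

(** No order between [w] and [x] enters, so that [w] can be either endpoint, with the same primitive
    [F] in both uses. *)
Lemma le_harmonic_increment (R : realType) (s a b q w x : R) (f f' F : R -> R) :
  0 <= s -> 0 < a -> 1 <= q ->
  {within `[a, b], continuous f} ->
  (forall u, u \in `]a, b[ -> is_derive u 1 f (f' u)) ->
  {within `[a, b], continuous F} ->
  (forall u, u \in `]a, b[ -> is_derive u 1 F (f u / u ^+ 2)) ->
  harmonically_s_convex s `[a, b] (fun u => `|f' u| `^ q) ->
  w \in `[a, b] -> x \in `[a, b] ->
  `|(w^-1 - x^-1) * f x - (F x - F w)| <=
  lambda5 w x `^ (1 - q^-1) * (x - w) ^+ 2 *
  (\int[@lebesgue_measure R]_(t in `[0, 1])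
      (t `^ (s + 1) / (t * w + (1 - t) * x) ^+ 2) * `|f' x| `^ q +
   \int[@lebesgue_measure R]_(t in `[0, 1])
      (t * (1 - t) `^ s / (t * w + (1 - t) * x) ^+ 2) * `|f' w| `^ q) `^ q^-1.
Proof.
move=> s0 a0 q1 cf df cF dF cvx wab xab.
(* Both sides vanish for [x = w]; otherwise [lambda5 w x] is the integral of the kernel. *)
have [->|xw] := eqVneq x w.
  by rewrite !subrr mul0r subrr normr0 expr0n/= mulr0 mul0r.
have [aw wb] : a <= w /\ w <= b by rewrite !(itvP wab).
have [ax xb] : a <= x /\ x <= b by rewrite !(itvP xab).
have w0 : 0 < w := lt_le_trans a0 aw.
have x0 : 0 < x := lt_le_trans a0 ax.
set k1 := fun t : R => t `^ (s + 1) / (t * w + (1 - t) * x) ^+ 2.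
set k2 := fun t : R => t * (1 - t) `^ s / (t * w + (1 - t) * x) ^+ 2.
pose k0 := fun t : R => t / (t * w + (1 - t) * x) ^+ 2.
have cK := within01_continuous_kernel w0 x0.
have s10 : 0 <= s + 1 by rewrite addr_ge0.
have ck0 : {within `[0, 1], continuous k0}.
  apply: within_continuousM cK; apply: continuous_subspaceT => ?; exact: cvg_id.
have ck1 : {within `[0, 1], continuous k1}.
  apply: within_continuousM cK.
  have := within01_continuous_powRM s10 (lexx 0).
  apply: subspace_eq_continuous => t _.
  by rewrite /from_subspace powRr0 mulr1.
have ck2 : {within `[0, 1], continuous k2}.
  apply: within_continuousM cK.
  have := within01_continuous_powRM (@ler01 R) s0.
  apply: subspace_eq_continuous => t /set_mem; rewrite /= in_itv/= => /andP[t0 _].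
  by rewrite /from_subspace powRr1.
pose D (t : R) := t * w + (1 - t) * x.
have D0 (t : R) : t \in `[0, 1] -> 0 < D t by exact: convex_comb_gt0.
pose u (t : R) := w * x / D t.
(* The product [m * t] equals [w^-1 - (u t)^-1]. *)
pose m : R := (x - w) / (w * x).
pose P (t : R) := m * t * f (u t) - F (u t).
have uab (t : R) : t \in `[0, 1] -> u t \in `[a, b].
  exact: harmonic_comb_itvcc.
have uoo (t : R) : t \in `]0, 1[ -> u t \in `]a, b[.
  exact: harmonic_comb_itvoo.
have du (t : R) : t \in `[0, 1] -> is_derive t 1 u (w * x * (x - w) / D t ^+ 2).
  move=> t01; have dD := is_derive_convex_comb w x t.
  have dV := is_deriveV (lt0r_neq0 (D0 _ t01)) dD.
  apply: is_derive_eq; rewrite /GRing.scale/= /D.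
  by field; rewrite gt_eqF// D0.
have cu : {within `[0, 1], continuous u}.
  by apply: derivable_within_continuous => t /du[].
have cP : {within `[0, 1], continuous P}.
  apply: within_continuousB; last first.
    exact: (within_continuous_comp_within uab cu cF).
  apply: within_continuousM; last first.
    exact: (within_continuous_comp_within uab cu cf).
  by apply: continuous_subspaceT => ?; exact: mulrl_continuous.
(* As [u' / u ^ 2 = m], the two terms containing [f (u t)] cancel, and only [m * t * u' * f' (u t)]
   remains. *)
have dP (t : R) : t \in `]0, 1[ ->
    is_derive t 1 P ((x - w) ^+ 2 * k0 t * f' (u t)).
  move=> t01; have tc := subset_itv_oo_cc t01.
  have dut := du _ tc.
  have dfu := is_derive1_comp (df _ (uoo _ t01)) dut.
  have dFu := is_derive1_comp (dF _ (uoo _ t01)) dut.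
  apply: is_derive_eq; rewrite /GRing.scale/= /k0 -/(D t) /u /m.
  field.
  by rewrite !gt_eqF// D0.
have ik := integrable_within_continuous.
pose K1 := \int[@lebesgue_measure R]_(t in `[0, 1]) k1 t.
pose K2 := \int[@lebesgue_measure R]_(t in `[0, 1]) k2 t.
have bound (c : R) : 0 < c -> `|P 1 - P 0| <= (x - w) ^+ 2 *
    (c / c `^ q * (K1 * `|f' x| `^ q + K2 * `|f' w| `^ q) / q
     + (1 - q^-1) * c * lambda5 w x).
  move=> c0; have q0 : 0 < q by lra.
  (* These are the coefficients of [k0], [k1] and [k2] in the function that dominates [|P'|] at the
     scale [c]. *)
  pose A0 := (x - w) ^+ 2 * ((1 - q^-1) * c).
  pose A1 := (x - w) ^+ 2 * (c / c `^ q * `|f' x| `^ q / q).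
  pose A2 := (x - w) ^+ 2 * (c / c `^ q * `|f' w| `^ q / q).
  have cst_cont (A : R) : {within `[0, 1], continuous (fun _ : R => A)}.
    by apply: continuous_subspaceT => ?; exact: cvg_cst.
  have cA0 := within_continuousM (cst_cont A0) ck0.
  have cA1 := within_continuousM (cst_cont A1) ck1.
  have cA2 := within_continuousM (cst_cont A2) ck2.
  have -> : (x - w) ^+ 2 *
      (c / c `^ q * (K1 * `|f' x| `^ q + K2 * `|f' w| `^ q) / q
       + (1 - q^-1) * c * lambda5 w x) =
    \int[@lebesgue_measure R]_(t in `[0, 1])
      (A0 * k0 t + (A1 * k1 t + A2 * k2 t)).
    rewrite RintegralD//; [|exact: ik..|exact/ik/within_continuousD].
    rewrite RintegralD//; [|exact: ik..].
    rewrite !RintegralZl//; [|exact: ik..].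
    rewrite kernel_Rintegral// -/K1 -/K2 /A0 /A1 /A2.
    by ring.
  apply: le_norm_increment_Rintegral dP _ => //.
    by apply: within_continuousD cA0 _; exact: within_continuousD.
  move=> t t01; have tc := subset_itv_oo_cc t01.
  have [t0 t1] : 0 < t /\ t < 1 by rewrite !(itvP t01).
  have k0_ge0 : 0 <= k0 t by rewrite mulr_ge0 ?invr_ge0 ?sqr_ge0// ltW.
  have t01' : 0 <= t <= 1 by rewrite !ltW.
  (* In this order of arguments the [s]-th power of [t] weights [x], and that of [1 - t] weights
     [w]. *)
  have := cvx w x t wab xab t01'; rewrite -/(D t) -/(u t) => cvxt.
  have xk : 0 <= (x - w) ^+ 2 * k0 t := mulr_ge0 (sqr_ge0 _) k0_ge0.
  rewrite normrM (ger0_norm xk).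
  (* Young's inequality bounds [|f' (u t)|] by its [q]-th power, which convexity then bounds. *)
  apply: (@le_trans _ _ ((x - w) ^+ 2 * k0 t *
     (c / c `^ q * (t `^ s * `|f' x| `^ q + (1 - t) `^ s * `|f' w| `^ q) / q
       + (1 - q^-1) * c))).
    apply: ler_wpM2l; first exact: xk.
    apply: (le_trans (le_scaled_powR q1 (normr_ge0 _) c0)).
    rewrite lerD2r ler_wpM2r ?invr_ge0 ?(ltW q0)//.
    by rewrite ler_wpM2l// divr_ge0 ?powR_ge0 ?ltW.
  have -> : k1 t = k0 t * t `^ s.
    rewrite /k1 /k0 powRD; last by rewrite (gt_eqF t0) implybT.
    by rewrite powRr1 ?(ltW t0)//; ring.
  have -> : k2 t = k0 t * (1 - t) `^ s by rewrite /k2 /k0; ring.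
  by rewrite /A0 /A1 /A2 le_eqVlt; apply/orP; left; apply/eqP; ring.
have xw2 : 0 < (x - w) ^+ 2 by rewrite exprn_even_gt0//= subr_eq0.
(* The path runs from [u 0 = w] to [u 1 = x], and [m = w^-1 - x^-1]. *)
have -> : (w^-1 - x^-1) * f x - (F x - F w) = P 1 - P 0.
  rewrite /P /u /D /m !mul1r !mul0r !subr0 !subrr !mul0r !mul1r addr0 add0r.
  rewrite mulfK ?gt_eqF// mulr0 mul0r [w * x / w]mulrAC divff ?gt_eqF// mul1r.
  by field; rewrite !gt_eqF.
(* Dividing by [(x - w) ^+ 2] gives the shape of [le_powR_mean] with [W = lambda5 w x], whose
   positivity is read off its integral form. *)
rewrite [_ * (x - w) ^+ 2]mulrC -mulrA -ler_pdivrMl//.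
apply: le_powR_mean => //.
- rewrite -kernel_Rintegral//; apply: Rintegral_within_continuous_gt0 => //.
  move=> t t01; have tc := subset_itv_oo_cc t01.
  by rewrite divr_gt0 ?exprn_gt0 ?(itvP t01)//; exact: D0.
- rewrite addr_ge0// mulr_ge0 ?powR_ge0//; apply: Rintegral_ge0 => t;
    rewrite /= in_itv/= => /andP[t0 t1].
    by rewrite divr_ge0 ?powR_ge0 ?sqr_ge0.
  by rewrite divr_ge0 ?sqr_ge0 ?mulr_ge0 ?powR_ge0.
- by move=> c c0; rewrite ler_pdivrMl//; exact: bound.
Qed.

(** * Relative derivatives and conclusion *)

(** Near [x] the difference quotients within [A] are bounded by [|l| + 1], with [l] their limit, so
    [|f z - f x|] is at most [(|l| + 1) * |z - x|]. This covers the points [a] and [b], where the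
    derivative may be one-sided. *)
Lemma derivable_in_continuous (R : realType) (A : set R) (f : R -> R) (x : R) :
  derivable_in A f x -> f @ within A (nbhs x) --> f x.
Proof.
move=> /cvg_ex[/= l fl]; apply/cvgrPdist_le => /= e e0.
have [d /= d0 dP] := (cvgrPdist_le _ _).1 fl 1 ltr01.
have L0 : 0 < `|l| + 1 by rewrite ltr_wpDl.
exists (Num.min d (e / (`|l| + 1))) => /=.
  by rewrite lt_min d0 divr_gt0.
move=> z /=; rewrite distrC lt_min => /andP[zd ze] Az.
have [->|zx] := eqVneq z x; first by rewrite subrr normr0 ltW.
have h0 : z - x != 0 by rewrite subr_eq0.
have := dP (z - x); rewrite /= sub0r normrN subrK => /(_ zd h0 Az) lz.
have -> : f x - f z = - ((z - x) * ((z - x)^-1 * (f z - f x))).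
  by rewrite mulVKf// opprB.
rewrite normrN normrM; apply: (@le_trans _ _ (e / (`|l| + 1) * (`|l| + 1))).
  apply: ler_pM => //; first exact: ltW.
  rewrite -[X in `|X|](subKr l) (le_trans (ler_normB _ _))// lerD2l//.
by rewrite divfK// gt_eqF.
Qed.

Theorem theorem6 (R : realType) (s : R) (I : set R) (f : R -> R) (a b q : R)
    (hs : 0 < s <= 1)
    (Iitv : is_interval I) (Ipos : I `<=` [set u | 0 < u])
    (df : forall u, I° u -> derivable f u 1)
    (Ia : I a) (Ib : I b) (ab : a < b)
    (dfab : forall u, u \in `[a, b] -> derivable_in I f u)
    (intf' : (@lebesgue_measure R).-integrable `[a, b]
               (fun u => (derive1_in I f u)%:E))
    (hq : 1 <= q)
    (cvx : harmonically_s_convex s `[a, b]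
             (fun u => `|derive1_in I f u| `^ q)) :
  forall x, x \in `[a, b] ->
  `| f x - a * b / (b - a) *
       \int[@lebesgue_measure R]_(u in `[a, b]) (f u / u ^+ 2) |
  <= a * b / (b - a) *
     (lambda5 a x `^ (1 - q^-1) * (x - a) ^+ 2 *
        (lambda1 a x s 1 1 * `|derive1_in I f x| `^ q
         + lambda2 a x s 1 1 * `|derive1_in I f a| `^ q) `^ q^-1
      + lambda5 b x `^ (1 - q^-1) * (b - x) ^+ 2 *
        (lambda3 b x s 1 1 * `|derive1_in I f x| `^ q
         + lambda4 b x s 1 1 * `|derive1_in I f b| `^ q) `^ q^-1).
Proof.
move=> x xab.
have s0 : 0 <= s by case/andP: hs => /ltW.
have [a0 b0] : 0 < a /\ 0 < b by split; exact: Ipos.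
have x0 : 0 < x by rewrite (lt_le_trans a0)// (itvP xab).
have abI : `[a, b] `<=` I.
  by move=> u; rewrite /= in_itv/=; exact: Iitv.
have abIo : `]a, b[ `<=` I°.
  rewrite -open_subsetE; last exact: interval_open.
  exact: subset_trans (@subset_itv_oo_cc _ _ _ _) abI.
have dfI (u : R) : u \in `]a, b[ -> is_derive u 1 f (derive1_in I f u).
  move=> /abIo uI; rewrite derive1_in_interior// derive1E.
  exact/derivableP/df.
have cf : {within `[a, b], continuous f}.
  apply/subspace_continuousP => u uab.
  have := derivable_in_continuous (dfab u uab).
  by apply: cvg_trans; apply: cvg_app; exact: within_subset.
have cfV : {within `[a, b], continuous (fun u => f u / u ^+ 2)}.
  apply: within_continuousM cf _; apply: derivable_within_continuous => u uab.
  apply: derivableV; last exact: exprn_derivable.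
  by rewrite expf_eq0/= gt_eqF// (lt_le_trans a0)// (itvP uab).
pose F u := \int[@lebesgue_measure R]_(v in `[a, u]) (f v / v ^+ 2).
have cF : {within `[a, b], continuous F}.
  apply: parameterized_integral_continuous; first exact: ltW.
  exact: integrable_within_continuous.
have dF (u : R) : u \in `]a, b[ -> is_derive u 1 F (f u / u ^+ 2).
  exact: is_derive_parameterized_integral.
have Fa : F a = 0 by rewrite /F set_itv1 Rintegral_set1.
have aab : a \in `[a, b] by rewrite in_itv/= lexx ltW.
have bab : b \in `[a, b] by rewrite in_itv/= lexx ltW.
have ba0 : 0 < b - a by rewrite subr_gt0.
have Ha := le_harmonic_increment s0 a0 hq cf dfI cF dF cvx aab xab.
have Hb := le_harmonic_increment s0 a0 hq cf dfI cF dF cvx bab xab.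
rewrite -(lambda1E a0 x0 s0) -(lambda2E a0 x0 s0) in Ha.
rewrite -(lambda3E b0 x0 s0) -(lambda4E b0 x0 s0) -[x - b]opprB sqrrN in Hb.
rewrite -/(F b).
(* In the difference the terms with [x^-1] and [F x] cancel, and [a^-1 - b^-1] is the inverse of the
   prefactor. *)
have -> : f x - a * b / (b - a) * F b = a * b / (b - a) *
    (((a^-1 - x^-1) * f x - (F x - F a)) - ((b^-1 - x^-1) * f x - (F x - F b))).
  by rewrite Fa; field; rewrite !gt_eqF.
have c0 : 0 <= a * b / (b - a) by rewrite divr_ge0 ?mulr_ge0// ltW.
rewrite normrM (ger0_norm c0) ler_wpM2l// (le_trans (ler_normB _ _))//.
exact: (lerD Ha Hb).
Qed.
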